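(* Let $k\ge 1$, let $M^3\subset\mathbb{R}^{3+k}$ be a regular (smoothly immersed) $3$-manifold and let $p\in M^3$. Then the curvature locus of $M^3$ at $p$ is generated by the union of the curvature ellipses at $p$ of the regular surfaces obtained as normal sections along the tangent directions of $M^3$ at $p$. That is, denoting by $\Delta_v(M^3,p)\subset N_pM^3$ the curvature locus of $M^3$ at $p$ and, for each non-zero $u\in T_pM^3$, by $M^2_u$ the normal section of $M^3$ along $u$ and by $\Delta_e(M^2_u,p)$ its curvature ellipse at $p$, $$\Delta_v(M^3,p)=\bigcup_{u\in T_pM^3\setminus\{0\}}\Delta_e(M^2_u,p).$$
   Context: For a regular $n$-manifold $M\subset\mathbb{R}^{n+k}$ ($n=2,3$) with local parametrisation $f$, the second fundamental form at $p$ is the symmetric bilinear map $II_p:T_pM\times T_pM\to N_pM$, $II_p(v,w)=\pi_2(d^2f(v,w))$, where $\pi_2$ is the orthogonal projection onto the normal space $N_pM=(T_pM)^\perp$ (tangent vectors being identified with parameter vectors through $df$). The curvature locus of $M$ at $p$ is the set $\{II_p(v,v): v\in T_pM,\ |v|=1\}\subset N_pM$. For $n=3$ it is denoted $\Delta_v$; for $n=2$ it is called the curvature ellipse and denoted $\Delta_e$ (it may degenerate to a segment or a point). Normal section: for non-zero $u\in T_pM^3$ let $\{u=0\}$ be the affine hyperplane of $\mathbb{R}^{3+k}$ through $p$ orthogonal to $u$. The normal section of $M^3$ along $u$ is the surface $M^2_u=M^3\cap\{u=0\}$ (near $p$), a regular surface in $\{u=0\}\cong\mathbb{R}^{2+k}$.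 Its tangent plane at $p$ is $T_pM^3\cap u^\perp$ and its normal space at $p$ inside $\{u=0\}$ is identified with $N_pM^3$, so that the curvature ellipse of $M^2_u$ is regarded as a subset of $N_pM^3$. *)

(* Defs.v *)
From HB Require Import structures.
From mathcomp Require Import all_boot all_order all_algebra.
From mathcomp Require Import all_classical all_reals all_analysis.
Set Implicit Arguments.
Unset Strict Implicit.
Unset Printing Implicit Defensive.
Import Order.TTheory GRing.Theory Num.Theory.
Import numFieldNormedType.Exports.
Local Open Scope classical_set_scope.
Local Open Scope ring_scope.

(* The canonical norm of 'rV[R]_m is the maximum of the coordinates, which
   gives the usual topology and derivatives; lengths and angles need the
   Euclidean structure below. *)
Definition edot (R : realType) (m : nat) (u v : 'rV[R]_m) : R :=
  \sum_(i < m) u 0 i * v 0 i.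

Definition enorm (R : realType) (m : nat) (v : 'rV[R]_m) : R :=
  Num.sqrt (edot v v).

(* Linear subspaces of R^m are row spaces of matrices. *)
Definition orth (R : realType) (l m : nat) (T : 'M[R]_(l, m)) : 'M[R]_m :=
  kermx T^T.

Fixpoint cont_diff_on (R : realType) (n m r : nat) (U : set 'rV[R]_n)
    (f : 'rV[R]_n -> 'rV[R]_m) : Prop :=
  if r is r'.+1 then
    (forall x, U x -> differentiable f x) /\
    (forall v, cont_diff_on r' U (fun x => 'D_v f x))
  else forall x, U x -> {for x, continuous f}.

Definition smooth_on (R : realType) (n m : nat) (U : set 'rV[R]_n)
    (f : 'rV[R]_n -> 'rV[R]_m) : Prop :=
  forall r, cont_diff_on r U f.

(* [iota : M -> R^m] is the immersion of the manifold M (the inclusion, when M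
   is a subspace of R^m); it need not be injective.  A local parametrisation of
   A `<=` M around q is a homeomorphism phi from U onto a relatively open part
   of A such that [iota \o phi] is a smooth immersion.  As rows are vectors, the
   differential of f at y is right multiplication by the matrix ['J f y]. *)
Definition local_param (R : realType) (n m : nat) (M : topologicalType)
    (iota : M -> 'rV[R]_m) (A : set M) (q : M)
    (U : set 'rV[R]_n) (phi : 'rV[R]_n -> M) (x : 'rV[R]_n) : Prop :=
  [/\ open U /\ U x,
      phi x = q,
      [/\ forall y, U y -> {for y, continuous phi},
          set_inj U phi
        & forall V, open V -> V `<=` U ->
            exists2 W : set M, open W & phi @` V = A `&` W],
      smooth_on U (iota \o phi)
    & forall y, U y -> row_free ('J (iota \o phi) y)].

(* The smooth structure is the one determined by iota: continuous changes of
   parametrisation are automatically smooth. *)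
Definition regular_manifold (R : realType) (n m : nat) (M : topologicalType)
    (iota : M -> 'rV[R]_m) : Prop :=
  [/\ hausdorff_space M,
      @second_countable M
    & forall q : M, exists (U : set 'rV[R]_n) (phi : 'rV[R]_n -> M) x,
        local_param iota setT q U phi x].

Definition tangent_space (R : realType) (n m : nat) (M : topologicalType)
    (iota : M -> 'rV[R]_m) (A : set M) (q : M) : set 'rV[R]_m :=
  [set v | exists (U : set 'rV[R]_n) (phi : 'rV[R]_n -> M) x,
    local_param iota A q U phi x /\ (v <= 'J (iota \o phi) x)%MS].

(* In the next definitions the ambient space is an affine subspace of R^m whose
   direction is the row space of H, so that normal spaces are taken inside H. *)
Definition normal_space (R : realType) (n m : nat) (H : 'M[R]_m)
    (f : 'rV[R]_n -> 'rV[R]_m) (x : 'rV[R]_n) : 'M[R]_m :=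
  (orth ('J f x) :&: H)%MS.

(* v and w are parameter vectors, standing for the tangent vectors ['d f x v]
   and ['d f x w].  On the row space of H, the matrix below is the orthogonal
   projection onto the normal space, whose orthogonal complement in H is the
   tangent space. *)
Definition second_fundamental_form (R : realType) (n m : nat) (H : 'M[R]_m)
    (f : 'rV[R]_n -> 'rV[R]_m) (x v w : 'rV[R]_n) : 'rV[R]_m :=
  'D_v (fun y => 'D_w f y) x *m proj_mx (normal_space H f x) <<'J f x>>%MS.

Definition curvature_locus_param (R : realType) (n m : nat) (H : 'M[R]_m)
    (f : 'rV[R]_n -> 'rV[R]_m) (x : 'rV[R]_n) : set 'rV[R]_m :=
  [set second_fundamental_form H f x v v
    | v in [set v | enorm ('d f x v) = 1]].

(* All local parametrisations of A around q give the same curvature locus. *)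
Definition curvature_locus_in (R : realType) (n m : nat) (H : 'M[R]_m)
    (M : topologicalType) (iota : M -> 'rV[R]_m) (A : set M) (q : M) :
    set 'rV[R]_m :=
  [set eta | exists (U : set 'rV[R]_n) (phi : 'rV[R]_n -> M) x,
    local_param iota A q U phi x /\
    curvature_locus_param H (iota \o phi) x eta].

Definition curvature_locus (R : realType) (m : nat) (M : topologicalType)
    (iota : M -> 'rV[R]_m) (q : M) : set 'rV[R]_m :=
  curvature_locus_in 3 1%:M iota setT q.

(* This set is a surface near q only, when u is a non-zero tangent vector; far
   from q it can be singular. *)
Definition normal_section (R : realType) (m : nat) (M : topologicalType)
    (iota : M -> 'rV[R]_m) (q : M) (u : 'rV[R]_m) : set M :=
  [set q' | edot (iota q' - iota q) u = 0].

Definition normal_section_curvature_ellipse (R : realType) (m : nat)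
    (M : topologicalType) (iota : M -> 'rV[R]_m) (q : M) (u : 'rV[R]_m) :
    set 'rV[R]_m :=
  curvature_locus_in 2 (orth u) iota (normal_section iota q u) q.

(* Main.v *)
(** A normal vector pairs with a position vector to a function that is critical
    at [p], and at a critical point the second derivative along a curve depends
    only on the velocity of the curve.  So the normal part of the acceleration
    of a curve of [M^3] through [p] depends only on its velocity, and for a
    curve in the section [M^2_u] it is the second fundamental form of either
    manifold, the normal space of the section inside the hyperplane [u = 0]
    being [N_p M^3].  This gives the inclusion of each ellipse in the locus.
    Conversely, a unit tangent vector [v] is tangent to the normal section along
    any tangent vector [u] orthogonal to [v]; that this section is a surface is
    the implicit function theorem for one equation. *)
Require Import Defs.
From mathcomp Require Import all_boot all_order all_algebra.
From mathcomp Require Import all_classical all_reals all_analysis.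
From mathcomp Require Import ring lra.
Set Implicit Arguments.
Unset Strict Implicit.
Unset Printing Implicit Defensive.
Import Order.TTheory GRing.Theory Num.Theory.
Import numFieldNormedType.Exports.
Local Open Scope classical_set_scope.
Local Open Scope ring_scope.

(** * Differentiability *)

Lemma rV_linear_continuous (R : realType) n (W : normedModType R)
  (f : {linear 'rV[R]_n -> W}) : continuous f.
Proof.
move=> x; apply: differentiable_continuous.
rewrite (_ : (f : 'rV[R]_n -> W) = \sum_(i < n)
    (fun v : 'rV[R]_n => v 0 i *: f (delta_mx 0 i))); last first.
  apply/funext => v; rewrite fct_sumE [in LHS](row_sum_delta v) linear_sum.
  by apply: eq_bigr => i _; rewrite linearZ.
apply: differentiable_sum => i; apply: differentiableZl.
exact: differentiable_coord.
Qed.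

Section DiffDist.
Context {R : realType} {V W : normedModType R}.

(** This and [dist_diff] trade the little-o form of the differential for explicit bounds, so that
    error terms can be combined by arithmetic. *)
Lemma diff_dist (f : V -> W) x : differentiable f x ->
  forall e, 0 < e ->
    \forall y \near x, `|f y - f x - 'd f x (y - x)| <= e * `|y - x|.
Proof.
move=> df e e0.
have /eqaddoP/(_ _ e0) : f \o shift x = cst (f x) + 'd f x +o_ 0 id.
  exact: diff_locally.
rewrite [X in X -> _](near_shift x 0); apply: filterS => y.
by rewrite sub0r !fctE /= subrK opprD addrA.
Qed.

Lemma dist_diff (f : V -> W) x (A : {linear V -> W}) : continuous A ->
  (forall e, 0 < e ->
     \forall y \near x, `|f y - f x - A (y - x)| <= e * `|y - x|) ->
  is_diff x f A.
Proof.
move=> Ac H.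
have E : f \o shift x = cst (f x) + A +o_ 0 id.
  apply/eqaddoP => e /H; rewrite (near_shift 0 x); apply: filterS => y /=.
  by rewrite subr0 !fctE /= addrK opprD addrA.
have dE := diff_unique Ac E.
split; last by rewrite dE.
by apply/diff_locallyP; rewrite dE; split.
Qed.

End DiffDist.

Lemma near_eq_is_diff (R : realType) (V W : normedModType R) (f g : V -> W) x :
  {near x, f =1 g} -> differentiable f x -> is_diff x g ('d f x).
Proof.
move=> fg df; apply: dist_diff; first exact: diff_continuous.
move=> e e0; near=> y.
rewrite -(nbhs_singleton fg) -(near fg y) //.
by near: y; exact: diff_dist.
Unshelve. all: by end_near. Qed.

Lemma near_eq_differentiable (R : realType) (V W : normedModType R)
    (f g : V -> W) x :
  {near x, f =1 g} -> differentiable f x -> differentiable g x.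
Proof. by move=> fg /(near_eq_is_diff fg) []. Qed.

Lemma derive_comp (R : realType) (U V W : normedModType R) (f : V -> W)
    (h : U -> V) a w :
  differentiable h a -> differentiable f (h a) ->
  'D_w (f \o h) a = 'D_('D_w h a) f (h a).
Proof.
move=> dh df; rewrite !deriveE//; last exact: differentiable_comp.
by rewrite diff_comp.
Qed.

Lemma derive_linear (R : realType) n (V W : normedModType R)
    (h : V -> 'rV[R]_n) (L : {linear 'rV[R]_n -> W}) a w :
  differentiable h a -> 'D_w (L \o h) a = L ('D_w h a).
Proof.
move=> dh; have Lc := @rV_linear_continuous _ _ _ L.
rewrite derive_comp//; last exact: linear_differentiable.
by rewrite deriveE; [rewrite diff_lin|exact: linear_differentiable].
Qed.

(** A continuous lift through an immersion inherits differentiability: a left inverse [K] of the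
    differential of [F] turns increments of [F \o c] back into increments of [c], up to errors that
    continuity of [c] makes small. The derivative of [c] is then that of [F \o c] followed by
    [K]. *)
Lemma diff_lift (R : realType) (V : normedModType R) n m
    (F : 'rV[R]_n -> 'rV[R]_m) (c : V -> 'rV[R]_n) a :
  differentiable F (c a) -> row_free ('J F (c a)) -> {for a, continuous c} ->
  differentiable (F \o c) a -> differentiable c a.
Proof.
move=> dF Ffree cc dG.
set J := 'J F (c a); set K := pinvmx J.
have JK : J *m K = 1%:M.
  by apply: (row_free_inj Ffree); rewrite mulmxKpV ?mul1mx.
have Kc : continuous (mulmxr K : 'rV[R]_m -> 'rV[R]_n).
  exact: rV_linear_continuous.
have [k k0 Kk] := linear_lipschitz Kc.
have [l l0 dGl] := linear_lipschitz (diff_continuous dG).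
suff : is_diff a c (mulmxr K \o 'd (F \o c) a) by case.
apply: dist_diff.
  by move=> v; apply: continuous_comp; [exact: diff_continuous|exact: Kc].
(* The expansion of [F] at [c a], multiplied by [K], recovers the increment of [c]; continuity of
   [c] carries the neighbourhood of [c a] back to [a]. *)
have key e : 0 < e -> \forall b \near a,
    `|c b - c a - mulmxr K (F (c b) - F (c a))| <= e * `|c b - c a|.
  move=> e0; have /= H := diff_dist dF (divr_gt0 e0 k0).
  near=> b.
  have Hb : `|F (c b) - F (c a) - 'd F (c a) (c b - c a)| <=
     e / k * `|c b - c a| by near: b; exact: cc H.
  have -> : c b - c a - mulmxr K (F (c b) - F (c a)) =
     - mulmxr K (F (c b) - F (c a) - 'd F (c a) (c b - c a)).
    rewrite [in RHS](linearB (mulmxr K)) opprB; congr (_ - _).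
    by rewrite -(mul_rV_lin1 ('d F (c a))) /= -mulmxA JK mulmx1.
  rewrite normrN (le_trans (Kk _))// -ler_pdivlMl// mulrA [_^-1 * _]mulrC.
  exact: Hb.
(* With the error in [key] at most half of [|c b - c a|], it is absorbed on the left, and [c] is
   Lipschitz at [a]. *)
have est : \forall b \near a, `|c b - c a| <= 2 * k * (l + 1) * `|b - a|.
  have half0 : 0 < 2^-1 :> R by [].
  near=> b.
  have h1 : `|c b - c a - mulmxr K (F (c b) - F (c a))| <= 2^-1 * `|c b - c a|.
    by near: b; exact: key.
  have h2 : `|F (c b) - F (c a) - 'd (F \o c) a (b - a)| <= 1 * `|b - a|.
    by near: b; exact: (diff_dist dG).
  have h3 := Kk (F (c b) - F (c a)).
  have h4 := dGl (b - a).
  have h5 : `|F (c b) - F (c a)| <= (l + 1) * `|b - a|.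
    rewrite -[X in `|X|](subrK ('d (F \o c) a (b - a))).
    by rewrite (le_trans (ler_normD _ _))// mulrDl addrC lerD.
  have h6 : `|c b - c a| <= 2^-1 * `|c b - c a| + k * `|F (c b) - F (c a)|.
    rewrite -[X in `|X| <= _](subrK (mulmxr K (F (c b) - F (c a)))).
    by rewrite (le_trans (ler_normD _ _))// lerD.
  have h7 : k * `|F (c b) - F (c a)| <= k * ((l + 1) * `|b - a|).
    by rewrite ler_pM2l.
  by rewrite -!mulrA; lra.
move=> e e0.
(* [e] is halved: one half pays for the expansion of [F], measured through the Lipschitz constant
   [C], the other for that of [F \o c], magnified by [k]. *)
pose C := 2 * k * (l + 1).
have C0 : 0 < C by rewrite !mulr_gt0// addr_gt0.
have e1 : 0 < e / 2 / C by rewrite !divr_gt0.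
have e2 : 0 < e / 2 / k by rewrite !divr_gt0.
near=> b.
have h1 : `|c b - c a - mulmxr K (F (c b) - F (c a))| <=
    e / 2 / C * `|c b - c a| by near: b; exact: key.
have h2 : `|F (c b) - F (c a) - 'd (F \o c) a (b - a)| <= e / 2 / k * `|b - a|.
  by near: b; exact: (diff_dist dG).
have h3 : `|c b - c a| <= C * `|b - a| by near: b; exact: est.
have h4 := Kk (F (c b) - F (c a) - 'd (F \o c) a (b - a)).
rewrite -(subrKA (mulmxr K (F (c b) - F (c a)))).
rewrite -[X in _ + X](linearB (mulmxr K)).
rewrite (le_trans (ler_normD _ _))//.
have -> : e * `|b - a| =
    e / 2 / C * (C * `|b - a|) + k * (e / 2 / k * `|b - a|).
  by field; rewrite !gt_eqF.
apply: lerD.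
  by rewrite (le_trans h1)// ler_pM2l.
by rewrite (le_trans h4)// ler_pM2l.
Unshelve. all: by end_near. Qed.

(** * Second-order expansion *)

Lemma derive_sum_coord (R : realType) n (W : normedModType R)
    (f : 'rV[R]_n -> W) (y h : 'rV[R]_n) : differentiable f y ->
  'D_h f y = \sum_(i < n) h 0 i *: 'D_(delta_mx 0 i) f y.
Proof.
move=> df; rewrite deriveE// [in LHS](row_sum_delta h) linear_sum.
by apply: eq_bigr => i _; rewrite linearZ deriveE.
Qed.

Lemma ler_coord_norm (R : realType) n (h : 'rV[R]_n) i : `|h 0 i| <= `|h|.
Proof.
by rewrite [leRHS]/Num.Def.normr/= mx_normrE; exact: (le_bigmax _ _ (0, i)).
Qed.

(** Expanding the inner direction leaves finitely many fixed partial derivatives, so that estimates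
    become uniform in [h]. *)
Lemma derive2_sum_coord (R : realType) n (f : 'rV[R]_n -> R) (x h : 'rV[R]_n) :
  (\forall y \near x, differentiable f y) ->
  (forall v, differentiable (fun y => 'D_v f y) x) ->
  'D_h (fun y => 'D_h f y) x =
    \sum_(i < n) h 0 i * 'D_h (fun y => 'D_(delta_mx 0 i) f y) x.
Proof.
move=> ndf d2f.
rewrite (@near_eq_derive _ _ _ (fun y => 'D_h f y)
  (\sum_(i < n) (fun y => h 0 i *: 'D_(delta_mx 0 i) f y : R)) x); last first.
  near=> y; rewrite /= derive_sum_coord; last by near: y.
  by rewrite fct_sumE.
rewrite derive_sum.
  apply: eq_bigr => i _; apply: (deriveZ (f := fun y => 'D_(delta_mx 0 i) f y)).
  by apply: diff_derivable; exact: d2f.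
move=> i; apply: (derivableZ (f := fun y => 'D_(delta_mx 0 i) f y)).
by apply: diff_derivable; exact: d2f.
Unshelve. all: by end_near. Qed.

Lemma is_derive_line (R : realType) (V W : normedModType R) (f : V -> W) x h
    (s : R) : derivable f (s *: h + x) h ->
  is_derive s 1 (fun s : R => f (s *: h + x)) ('D_h f (s *: h + x)).
Proof.
have E : (fun t : R => t^-1 *: (f ((t *: 1 + s) *: h + x) - f (s *: h + x))) =
  (fun t : R => t^-1 *: (f (t *: h + (s *: h + x)) - f (s *: h + x))).
  apply/funext => t; congr (_ *: (f _ - _)).
  by rewrite scalerDl addrA -[t *: 1]/(t * 1) mulr1.
by move=> df; apply: DeriveDef; rewrite /derivable /derive /= E.
Qed.

(** The mean value theorem on the segment from [x] to [h + x] reduces the second-order remainder to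
    the first-order remainders of the partial derivatives at [x]. *)
Lemma taylor2 (R : realType) n (f : 'rV[R]_n -> R) (x : 'rV[R]_n) :
  (\forall y \near x, differentiable f y) ->
  (forall v, differentiable (fun y => 'D_v f y) x) ->
  forall e : R, 0 < e -> \forall h \near (0 : 'rV[R]_n),
    `|f (h + x) - f x - 'D_h f x - 2^-1 * 'D_h (fun y => 'D_h f y) x|
      <= e * `|h| ^+ 2.
Proof.
move=> ndf d2f e e0.
pose E i : 'rV[R]_n := delta_mx 0 i.
(* The share of [e] granted to each of the [n] coordinates; the successor keeps the divisor nonzero
   when [n = 0]. *)
have e1 : 0 < e / n.+1%:R by rewrite divr_gt0.
have : \forall y \near x, differentiable f y /\ forall i,
    `|'D_(E i) f y - 'D_(E i) f x - 'd (fun y => 'D_(E i) f y) x (y - x)|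
      <= e / n.+1%:R * `|y - x|.
  near=> y; split; first by near: y.
  by near: y; apply: filter_forall => i; exact: (diff_dist (d2f _)).
move=> /nbhs_ballP[d /= d0 Hd].
apply/nbhs_ballP; exists d => //= h.
rewrite -ball_normE /= sub0r normrN => hd.
have inball s : `|s| <= 1 -> ball x d (s *: h + x).
  move=> s1; rewrite -ball_normE /= opprD addrCA subrr addr0 normrN normrZ.
  by rewrite (le_lt_trans _ hd)// ler_piMl.
set Q := 'D_h (fun y => 'D_h f y) x.
have QE : Q = \sum_(i < n) h 0 i * 'd (fun y => 'D_(E i) f y) x h.
  by rewrite /Q derive2_sum_coord//; apply: eq_bigr => i _; rewrite deriveE.
(* Chosen so that [phi 1 - phi 0] is the remainder to be bounded, while its derivative [dphi] is a
   first-order remainder. *)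
pose phi (s : R) : R := f (s *: h + x) - s * 'D_h f x - s ^+ 2 * (2^-1 * Q).
pose dphi (s : R) : R := 'D_h f (s *: h + x) - 'D_h f x - s * Q.
have dphiE (s : R) : `|s| <= 1 -> is_derive s 1 phi (dphi s).
  move=> s1.
  have dfs : differentiable f (s *: h + x) by have [] := Hd _ (inball _ s1).
  have D1 : is_derive s 1 (fun s : R => f (s *: h + x)) ('D_h f (s *: h + x)).
    by apply: is_derive_line; exact: diff_derivable.
  rewrite /phi /dphi.
  apply: is_derive_eq.
  by rewrite /GRing.scale /=; field.
have [s s01 phiE] : exists2 s, s \in `]0, 1[ & phi 1 - phi 0 = dphi s * (1 - 0).
  apply: MVT => // [s|].
    rewrite in_itv /= => /andP[s0 s1].
    by apply: dphiE; rewrite ger0_norm ltW.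
  apply: derivable_within_continuous => s; rewrite in_itv /= => /andP[s0 s1].
  suff : is_derive s 1 phi (dphi s) by case.
  by apply: dphiE; rewrite ger0_norm.
move: phiE; rewrite subr0 mulr1 /phi /dphi scale1r scale0r add0r => phiE.
have -> : f (h + x) - f x - 'D_h f x - 2^-1 * Q =
   'D_h f (s *: h + x) - 'D_h f x - s * Q by rewrite -phiE; ring.
have s1 : `|s| <= 1.
  by move: s01; rewrite in_itv /= => /andP[s0 s1]; rewrite ger0_norm ltW.
have [dfs dEs] := Hd _ (inball _ s1).
rewrite QE (derive_sum_coord _ dfs) (derive_sum_coord _ (nbhs_singleton ndf)).
rewrite mulr_sumr -!sumrB (le_trans (ler_norm_sum _ _ _))//.
apply: (@le_trans _ _ (\sum_(i < n) `|h| * (e / n.+1%:R * `|h|))); last first.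
  rewrite sumr_const card_ord -[leLHS]mulr_natr.
  rewrite (_ : _ * n%:R = e * `|h| ^+ 2 * (n%:R / n.+1%:R)); last first.
    have : n.+1%:R != 0 :> R by rewrite pnatr_eq0.
    by move: (n.+1%:R) => N N0; field.
  apply: ler_piMr; first by rewrite !mulr_ge0// ltW.
  by rewrite ler_pdivrMr ?mul1r ?ler_nat.
apply: ler_sum => i _.
have := dEs i; rewrite addrK linearZ /= => H.
rewrite /GRing.scale /= mulrCA -!mulrBr normrM.
apply: ler_pM => //; first exact: ler_coord_norm.
rewrite (le_trans H)// ler_pM2l// normrZ.
by rewrite ler_piMl.
Unshelve. all: by end_near. Qed.

Section CriticalSecondDerivative.
Context {R : realType} {n : nat}.
Implicit Types (f : 'rV[R]_n -> R) (x : 'rV[R]_n).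

Lemma derive2_continuous f x :
  (\forall y \near x, differentiable f y) ->
  (forall v, differentiable (fun y => 'D_v f y) x) ->
  continuous (fun h : 'rV[R]_n => 'D_h (fun y => 'D_h f y) x).
Proof.
move=> ndf d2f.
rewrite (_ : (fun h : 'rV[R]_n => _) = fun h : 'rV[R]_n => \sum_(i < n) (h 0 i *
    'd (fun y => 'D_(delta_mx 0 i) f y) x h)); last first.
  apply/funext => h; rewrite derive2_sum_coord//.
  by apply: eq_bigr => i _; rewrite deriveE.
apply: continuous_big => [|i _ h]; first exact: add_continuous.
apply: (cvgM (@coord_continuous R _ _ 0 i h)).
exact: diff_continuous (d2f _) _.
Qed.

(* At a critical point the second-order part of [f] along a curve depends only
   on the velocity of the curve, which need not be twice differentiable. *)
Lemma critical_second_order f x (c : R -> 'rV[R]_n) v :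
  (\forall y \near x, differentiable f y) ->
  (forall v, differentiable (fun y => 'D_v f y) x) ->
  (forall v, 'D_v f x = 0) ->
  t^-1 *: (c t - x) @[t --> 0^'] --> v ->
  (t ^+ 2)^-1 * (f (c t) - f x) @[t --> 0^'] -->
    2^-1 * 'D_v (fun y => 'D_v f y) x.
Proof.
move=> ndf d2f df0 cv.
pose k (t : R) := t^-1 *: (c t - x).
have kE t : t != 0 -> c t = t *: k t + x.
  by move=> t0; rewrite /k scalerA divff// scale1r subrK.
have c0 : t *: k t @[t --> 0^'] --> (0 : 'rV[R]_n).
  rewrite -(scale0r v); apply: cvgZ => //.
  exact: cvg_within.
pose q (h : 'rV[R]_n) := 'D_h (fun y => 'D_h f y) x.
have qZ t h : q (t *: h) = t ^+ 2 * q h.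
  rewrite /q !derive2_sum_coord// mulr_sumr; apply: eq_bigr => i _.
  rewrite !mxE !deriveE; [|exact: d2f|exact: d2f].
  by rewrite linearZ /= /GRing.scale /=; ring.
have qk : q (k t) @[t --> 0^'] --> q v.
  by apply: cvg_comp cv _; exact: derive2_continuous.
have lim : (2^-1 * q (k t)) + ((t ^+ 2)^-1 * (f (c t) - f x) - 2^-1 * q (k t))
    @[t --> 0^'] --> 2^-1 * q v + 0.
  apply: cvgD; first by apply: cvgM => //; exact: cvg_cst.
  apply/cvgrPdist_le => e e0.
  (* Since [k t] tends to [v], its norm is eventually at most [|v| + 1]; dividing [e] by the square
     of this bound makes the Taylor error at most [e * t ^+ 2]. *)
  have V1 : 0 < `|v| + 1 by rewrite ltr_wpDl.
  have e1 : 0 < e / (`|v| + 1) ^+ 2 by rewrite divr_gt0// exprn_gt0.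
  near=> t.
  have t0 : t != 0 by near: t; exact: nbhs_dnbhs_neq.
  have kv : `|k t| <= `|v| + 1.
    rewrite -[X in `|X|](subrK v) addrC (le_trans (ler_normD _ _))// lerD2l.
    rewrite distrC; near: t; have /cvgrPdist_le := cv; apply; exact: ltr01.
  have : `|f (t *: k t + x) - f x - 'D_(t *: k t) f x -
      2^-1 * 'D_(t *: k t) (fun y => 'D_(t *: k t) f y) x| <=
      e / (`|v| + 1) ^+ 2 * `|t *: k t| ^+ 2.
    by near: t; exact: c0 (taylor2 ndf d2f e1).
  rewrite -kE// df0 subr0 -/(q _) qZ sub0r normrN => H.
  rewrite (_ : _ - _ =
      (t ^+ 2)^-1 * (f (c t) - f x - 2^-1 * (t ^+ 2 * q (k t)))).
    rewrite normrM (ger0_norm (x := _^-1)) ?invr_ge0 ?sqr_ge0//.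
    rewrite ler_pdivrMl ?exprn_even_gt0//.
    rewrite (le_trans H)// normrZ exprMn real_normK ?num_real//.
    rewrite mulrCA ler_pM2l ?exprn_even_gt0//.
    rewrite mulrAC ler_pdivrMr ?exprn_gt0// ler_pM2l//.
    by rewrite lerXn2r ?nnegrE// ltW.
  by field.
rewrite -[X in _ --> X]/(2^-1 * q v) -[X in _ --> X]addr0.
apply: cvg_trans lim; apply: near_eq_cvg; near=> t.
by rewrite addrC subrK.
Unshelve. all: by end_near. Qed.

End CriticalSecondDerivative.

(** The value of [g] along the line through [y] with velocity [w] is the value of [f] along the
    image of this line under [h], whose velocity is ['D_w h y]. Both points are critical, so one
    second-order quotient has both sides as limits; [h] enters only through its first derivative. *)
Lemma critical_derive2_comp (R : realType) m n (f : 'rV[R]_n -> R)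
    (h : 'rV[R]_m -> 'rV[R]_n) (g : 'rV[R]_m -> R) y w :
  (\forall z \near h y, differentiable f z) ->
  (forall v, differentiable (fun z => 'D_v f z) (h y)) ->
  (\forall z \near y, differentiable g z) ->
  (forall v, differentiable (fun z => 'D_v g z) y) ->
  (forall v, 'D_v f (h y) = 0) -> differentiable h y ->
  {near y, f \o h =1 g} ->
  'D_w (fun z => 'D_w g z) y =
    'D_('D_w h y) (fun z => 'D_('D_w h y) f z) (h y).
Proof.
move=> ndf d2f ndg d2g df0 dh fg.
have dg0 u : 'D_u g y = 0.
  rewrite -(near_eq_derive _ fg) derive_comp ?df0//.
  exact: (nbhs_singleton ndf).
have cg : t^-1 *: ((t *: w + y) - y) @[t --> (0 : R)^'] --> w.
  apply: (@cvg_trans _ (cst w @ (0 : R)^')); last exact: cvg_cst.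
  apply: near_eq_cvg; near=> t.
  have t0 : t != 0 by near: t; exact: nbhs_dnbhs_neq.
  by rewrite addrK scalerA mulVf// scale1r.
have ch : t^-1 *: (h (t *: w + y) - h y) @[t --> (0 : R)^'] --> 'D_w h y.
  have : derivable h y w by exact: diff_derivable.
  by [].
have lg := critical_second_order ndg d2g dg0 cg.
have lf := critical_second_order ndf d2f df0 ch.
have half0 : 2^-1 != 0 :> R by rewrite invr_eq0 pnatr_eq0.
apply: (mulfI half0).
apply: (cvg_unique _ lg _); first exact: Rhausdorff.
apply: cvg_trans lf.
have fy : f (h y) = g y := nbhs_singleton fg.
apply: near_eq_cvg; near=> t; rewrite /= fy.
suff -> : g (t *: w + y) = f (h (t *: w + y)) by [].
near: t.
have cy : t *: w + y @[t --> (0 : R)^'] --> y.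
  rewrite -[X in _ --> X]add0r -[X in _ --> X + _](scale0r w).
  by apply: cvgD; [apply: cvgZr_tmp; exact: cvg_within|exact: cvg_cst].
by apply: (cy [set z | g z = f (h z)]); apply: filterS fg => z /= ->.
Unshelve. all: by end_near. Qed.

(** * Normal projections *)

Section NormalProjection.
Context {R : realType} {m : nat}.

Lemma edotE (u v : 'rV[R]_m) : edot u v = (u *m v^T) 0 0.
Proof. by rewrite mxE; apply: eq_bigr => i _; rewrite mxE. Qed.

Lemma edot_eq0 (u v : 'rV[R]_m) : (edot u v == 0) = (u *m v^T == 0).
Proof.
apply/eqP/eqP => [uv0|uv0]; last by rewrite edotE uv0 mxE.
by apply/matrixP => i j; rewrite !ord1 [RHS]mxE -edotE.
Qed.

Lemma edot_ge0 (u : 'rV[R]_m) : 0 <= edot u u.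
Proof. by apply: sumr_ge0 => i _; exact: sqr_ge0. Qed.

Lemma edot_self_eq0 (u : 'rV[R]_m) : (edot u u == 0) = (u == 0).
Proof.
apply/eqP/eqP => [/eqP|->]; last first.
  by rewrite /edot big1// => i _; rewrite mxE mul0r.
rewrite /edot psumr_eq0 => [/allP /= u0|i _]; last exact: sqr_ge0.
apply/rowP => i; rewrite mxE; apply/eqP.
by have := u0 i (mem_index_enum _); rewrite mulf_eq0 orbb.
Qed.

(** [w *m (A *m A^T) *m w^T] is the squared Euclidean length of [w *m A]. *)
Lemma mulmx_gram_eq0 l (A : 'M[R]_(l, m)) (w : 'rV[R]_l) :
  w *m (A *m A^T) = 0 -> w *m A = 0.
Proof.
move=> w0; apply/eqP; rewrite -edot_self_eq0 edot_eq0 trmx_mul.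
by rewrite mulmxA -(mulmxA w) w0 mul0mx.
Qed.

Lemma gram_unit l (A : 'M[R]_(l, m)) : row_free A -> A *m A^T \in unitmx.
Proof.
move=> Afree; rewrite -row_free_unit; apply: inj_row_free => v /mulmx_gram_eq0.
by move=> vA; apply: (row_free_inj Afree); rewrite vA mul0mx.
Qed.

Lemma orth_cap_eq0 l (A : 'M[R]_(l, m)) : (orth A :&: A)%MS = 0.
Proof.
apply/eqP/rowV0P => v; rewrite sub_capmx => /andP[/sub_kermxP vA /submxP[w vE]].
by rewrite vE; apply: mulmx_gram_eq0; rewrite mulmxA -vE.
Qed.

Lemma orth_decomp l (A : 'M[R]_(l, m)) (z : 'rV[R]_m) : row_free A ->
  exists2 a, (a <= A)%MS & (z - a <= orth A)%MS.
Proof.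
(* The witness is the orthogonal projection of [z] onto the row space of [A], as given by the normal
   equations of least squares. *)
move=> Afree; exists (z *m A^T *m invmx (A *m A^T) *m A); first exact: submxMl.
apply/sub_kermxP; rewrite mulmxBl -(mulmxA _ A) mulmxKV ?subrr//.
exact: gram_unit.
Qed.

Variables (n : nat) (T : 'M[R]_(n.+1, m)) (S : 'M[R]_(n, m)) (u : 'rV[R]_m).
Hypotheses (Tfree : row_free T) (Sfree : row_free S) (ST : (S <= T)%MS)
  (uT : (u <= T)%MS) (u0 : u != 0) (Su : S *m u^T = 0).

(** A dimension count: the rows of [S] and the vector [u] orthogonal to them are [n + 1] independent
    vectors inside [T], which has rank [n + 1]. *)
Lemma hyperplane_add_normal : (T <= S + u)%MS.
Proof.
have Cfree : row_free (col_mx S u).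
  apply: inj_row_free => v; rewrite -[v]hsubmxK mul_row_col => v0.
  have ru0 : rsubmx v *m u = 0.
    apply: mulmx_gram_eq0; have := congr1 (mulmx^~ u^T) v0.
    by rewrite mulmxDl -mulmxA Su mulmx0 add0r mul0mx mulmxA.
  have lu0 : lsubmx v = 0.
    apply: (row_free_inj Sfree); rewrite mul0mx.
    by move: v0; rewrite ru0 addr0.
  have ufree : row_free u by rewrite -row_leq_rank rank_rV u0.
  have r0 : rsubmx v = 0 by apply: (row_free_inj ufree); rewrite ru0 mul0mx.
  by rewrite lu0 r0 row_mx0.
have CT : (col_mx S u <= T)%MS by rewrite col_mx_sub ST.
rewrite addsmxE; have [rCT <-] := mxrank_leqif_sup CT.
by rewrite (eqP Cfree) (eqP Tfree) addn1.
Qed.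

(** This is the identification of the normal space of the section inside the hyperplane with that of
    the manifold; it holds because [T] is spanned by [S] and [u]. *)
Lemma normal_space_hyperplane : (orth T :&: 1%:M :=: orth S :&: orth u)%MS.
Proof.
apply/eqmxP/andP; split.
  rewrite (submx_trans (capmxSl _ _))// sub_capmx.
  apply/andP; split; apply/sub_kermxP.
    have /submxP[D ->] := ST.
    by rewrite trmx_mul mulmxA mulmx_ker mul0mx.
  have /submxP[D ->] := uT.
  by rewrite trmx_mul mulmxA mulmx_ker mul0mx.
rewrite sub_capmx submx1 andbT; apply/sub_kermxP.
have /sub_addsmxP[[D E] /= ->] := hyperplane_add_normal.
rewrite linearD /= !trmx_mul mulmxDr !mulmxA.
have /sub_kermxP -> : (orth S :&: orth u <= kermx S^T)%MS by exact: capmxSl.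
have /sub_kermxP -> : (orth S :&: orth u <= kermx u^T)%MS by exact: capmxSr.
by rewrite !mul0mx addr0.
Qed.

(** [z] and [z'] stand for the accelerations in the manifold and in the section. Removing from [z']
    its component in [S] leaves a vector of the common normal space, and [z] differs from that
    vector by an element of [T]. *)
Lemma normal_projection_eq (z z' : 'rV[R]_m) :
  z' *m u^T = 0 -> (z - z' <= T)%MS ->
  z *m proj_mx (orth T :&: 1%:M)%MS <<T>>%MS =
  z' *m proj_mx (orth S :&: orth u)%MS <<S>>%MS.
Proof.
move=> z'u zz'.
have [a aS na] := orth_decomp z' Sfree.
have nN : (z' - a <= orth S :&: orth u)%MS.
  rewrite sub_capmx na; apply/sub_kermxP; rewrite mulmxBl z'u.
  by have /submxP[D ->] := aS; rewrite -mulmxA Su mulmx0 subr0.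
have capT : ((orth T :&: 1%:M) :&: <<T>>)%MS = 0.
  apply/eqP; rewrite -submx0 -(orth_cap_eq0 T) capmxS ?genmxE//.
  exact: capmxSl.
have capS : ((orth S :&: orth u) :&: <<S>>)%MS = 0.
  apply/eqP; rewrite -submx0 -(orth_cap_eq0 S) capmxS ?genmxE//.
  exact: capmxSl.
have {1}-> : z = (z' - a) + (z - z' + a).
  by rewrite [_ - z' + a]addrC subrKA addrC subrK.
rewrite mulmxDl (proj_mx_id capT) ?normal_space_hyperplane//.
have zT : ((z - z' + a)%R <= T)%MS by rewrite addmx_sub// (submx_trans aS).
rewrite (proj_mx_0 capT) ?genmxE//.
rewrite -[z' in RHS](subrK a) mulmxDl (proj_mx_id capS)//.
by rewrite (proj_mx_0 capS) ?genmxE.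
Qed.

End NormalProjection.

(** * Smooth functions *)

(** The scalar counterpart of [cont_diff_on]: products and inverses are available for values in [R],
    and [cont_diff_onP] brings the results back to vectors. *)
Fixpoint cont_diff (R : realType) n r (U : set 'rV[R]_n) (f : 'rV[R]_n -> R)
    : Prop :=
  if r is r'.+1 then
    (forall x, U x -> differentiable f x) /\
    (forall v, cont_diff r' U (fun x => 'D_v f x))
  else forall x, U x -> {for x, continuous f}.

Lemma rV_sum_coord (R : realType) (T : Type) m (F : T -> 'rV[R]_m) :
  F = fun t => \sum_(j < m) F t 0 j *: delta_mx 0 j.
Proof. by apply/funext => t; rewrite -row_sum_delta. Qed.

Lemma differentiable_rVP (R : realType) (V : normedModType R) m
    (F : V -> 'rV[R]_m) x :
  differentiable F x <-> forall j, differentiable (fun y => F y 0 j) x.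
Proof.
split=> [dF j|dF].
  apply: (differentiable_comp (f := F) (g := fun N : 'rV[R]_m => N 0 j)) => //.
  exact: differentiable_coord.
rewrite (rV_sum_coord F) (_ : (fun t => _) =
    \sum_(j < m) (fun t => F t 0 j *: delta_mx 0 j : 'rV[R]_m)); last first.
  by apply/funext => t; rewrite fct_sumE.
by apply: differentiable_sum => j; apply: differentiableZl.
Qed.

Lemma continuous_rVP (R : realType) (T : topologicalType) m
    (F : T -> 'rV[R]_m) x :
  {for x, continuous F} <-> forall j, {for x, continuous (fun y => F y 0 j)}.
Proof.
split=> [cF j|cF].
  apply: (continuous_comp (f := F) (g := fun N : 'rV[R]_m => N 0 j)) => //.
  exact: coord_continuous.
apply/cvgrPdist_lt => e e0; near=> y.
rewrite [ltLHS]/Num.Def.normr/= mx_normrE; apply: bigmax_lt => // -[i j] _ /=.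
rewrite ord1 !mxE; move: j {i}; near: y; apply: filter_forall => j.
exact: (cvgrPdist_lt _ _).1 (cF j) _ e0.
Unshelve. all: by end_near. Qed.

Lemma derive_coord (R : realType) (V : normedModType R) m
    (F : V -> 'rV[R]_m) x v j :
  differentiable F x -> 'D_v F x 0 j = 'D_v (fun y => F y 0 j) x.
Proof.
by move=> dF; rewrite derive_mx ?mxE//; exact: diff_derivable.
Qed.

Section ContDiff.
Context {R : realType} {n : nat} (U : set 'rV[R]_n) (Uo : open U).
Implicit Types f g : 'rV[R]_n -> R.

Let nearU x : U x -> \forall y \near x, U y.
Proof. by move=> Ux; move: Uo; rewrite openE => /(_ x Ux). Qed.

Lemma cont_diff_ext r f g :
  (forall x, U x -> f x = g x) -> cont_diff r U f -> cont_diff r U g.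
Proof.
elim: r f g => [|r IH] f g fg /=.
  move=> cf x Ux; have fgx : {near x, f =1 g}.
    by apply: filterS (nearU Ux) => y /fg.
  rewrite /prop_for /continuous_at -(fg x Ux).
  apply: cvg_trans (cf x Ux); apply: near_eq_cvg; first exact: nbhs_filter.
  by apply: filterS fgx.
move=> [df cf]; split=> [x Ux|v].
  apply: near_eq_differentiable (df x Ux).
  by apply: filterS (nearU Ux) => y /fg.
apply: IH (cf v) => x Ux; apply: near_eq_derive.
by apply: filterS (nearU Ux) => y /fg.
Qed.

Lemma cont_diffW r f : cont_diff r.+1 U f -> cont_diff r U f.
Proof.
elim: r f => [|r IH] f [df cf].
  by move=> x Ux; apply: differentiable_continuous; exact: df.
by split=> // v; exact: IH (cf v).
Qed.

Lemma cont_diff_cst r (a : R) : cont_diff r U (cst a).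
Proof.
elim: r a => [|r IH] a /=; first by move=> x _; exact: cst_continuous.
split=> [x _|v]; first exact: differentiable_cst.
by apply: cont_diff_ext (IH 0) => x _; rewrite derive_cst.
Qed.

Lemma cont_diffD r f g : cont_diff r U f -> cont_diff r U g ->
  cont_diff r U (fun x => f x + g x).
Proof.
elim: r f g => [|r IH] f g /=.
  by move=> cf cg x Ux; apply: continuousD; [exact: cf|exact: cg].
move=> [df cf] [dg cg]; split=> [x Ux|v].
  by apply: differentiableD; [exact: df|exact: dg].
apply: cont_diff_ext (IH _ _ (cf v) (cg v)) => x Ux.
by rewrite deriveD//; apply: diff_derivable; [exact: df|exact: dg].
Qed.

(** The product rule mixes each function with the derivative of the other, so the induction also
    needs [f] and [g] themselves at the lower class. *)
Lemma cont_diffM r f g : cont_diff r U f -> cont_diff r U g ->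
  cont_diff r U (fun x => f x * g x).
Proof.
elim: r f g => [|r IH] f g.
  by move=> cf cg x Ux; apply: continuousM; [exact: cf|exact: cg].
move=> cf1 cg1; have [cf0 cg0] := (cont_diffW cf1, cont_diffW cg1).
case: cf1 cg1 => [df cf] [dg cg]; split=> [x Ux|v].
  by apply: (differentiableM (f := f) (g := g)); [exact: df|exact: dg].
apply: cont_diff_ext (cont_diffD (IH _ _ cf0 (cg v)) (IH _ _ cg0 (cf v))).
move=> x Ux; rewrite (deriveM (f := f) (g := g))//; apply: diff_derivable.
  exact: df.
exact: dg.
Qed.

Lemma cont_diffV r f : (forall x, U x -> f x != 0) -> cont_diff r U f ->
  cont_diff r U (fun x => (f x)^-1).
Proof.
move=> f0; elim: r => [|r IH].
  by move=> cf x Ux; apply: continuousV; [exact: f0|exact: cf].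
move=> cf1; have cV := IH (cont_diffW cf1).
case: cf1 => [df cf]; split=> [x Ux|v].
  by apply: differentiableV; [exact: df|exact: f0].
apply: cont_diff_ext (cont_diffM (cont_diff_cst r (-1))
  (cont_diffM (cont_diffM cV cV) (cf v))) => x Ux.
rewrite deriveV ?f0//; last by apply: diff_derivable; exact: df.
by rewrite mulN1r -scaleNr /GRing.scale /= expr2 invfM mulNr.
Qed.

Lemma cont_diff_sum r (I : Type) (s : seq I) (F : I -> 'rV[R]_n -> R) :
  (forall i, cont_diff r U (F i)) ->
  cont_diff r U (fun x => \sum_(i <- s) F i x).
Proof.
move=> cF; elim: s => [|i s IH].
  by apply: cont_diff_ext (cont_diff_cst r 0) => x _; rewrite big_nil.
apply: cont_diff_ext (cont_diffD (cF i) IH) => x _.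
by rewrite big_cons.
Qed.

Lemma cont_diff_onP r m (F : 'rV[R]_n -> 'rV[R]_m) :
  cont_diff_on r U F <-> forall j, cont_diff r U (fun x => F x 0 j).
Proof.
elim: r F => [|r IH] F /=.
  split=> [cF j x /cF /continuous_rVP //|cF x Ux].
  by apply/continuous_rVP => j; exact: cF.
split=> [[dF cF] j|cF].
  split=> [x /dF /differentiable_rVP//|v].
  have /IH/(_ j) := cF v; apply: cont_diff_ext => x Ux.
  by rewrite derive_coord//; exact: dF.
have dF x : U x -> differentiable F x.
  by move=> Ux; apply/differentiable_rVP => j; have [+ _] := cF j; apply.
split=> // v; apply/IH => j; have [_ /(_ v)] := cF j.
by apply: cont_diff_ext => x Ux; rewrite derive_coord//; exact: dF.
Qed.

End ContDiff.

(** In coordinates the chain rule is a sum of products of partial derivatives of [h] with partial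
    derivatives of [f] composed with [h]; the induction on [r] therefore runs over all [f]. *)
Lemma cont_diff_comp (R : realType) n m r (U : set 'rV[R]_n) (V : set 'rV[R]_m)
    (f : 'rV[R]_n -> R) (h : 'rV[R]_m -> 'rV[R]_n) :
  open U -> open V -> (forall y, V y -> U (h y)) ->
  cont_diff r U f -> cont_diff_on r V h -> cont_diff r V (f \o h).
Proof.
move=> Uo Vo hVU; elim: r f => [|r IH] f.
  by move=> cf ch y Vy; apply: continuous_comp; [exact: ch|exact/cf/hVU].
move=> [df cf] ch; have ch0 : cont_diff_on r V h.
  apply/(cont_diff_onP Vo) => j; apply: cont_diffW.
  by move: ch => /(cont_diff_onP Vo).
have [dh _] := ch; split=> [y Vy|w].
  by apply: differentiable_comp; [exact: dh|exact/df/hVU].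
have dhj i : cont_diff r V (fun y => 'D_w (fun z => h z 0 i) y).
  by have /(cont_diff_onP Vo)/(_ i)[_] := ch; exact.
apply: (@cont_diff_ext _ _ _ Vo _ (fun y => \sum_(i < n)
    ('D_w (fun z => h z 0 i) y * ('D_(delta_mx 0 i) f \o h) y))).
  move=> y Vy; rewrite derive_comp; [|exact: dh|exact/df/hVU].
  rewrite derive_sum_coord; last exact/df/hVU.
  by apply: eq_bigr => i _; rewrite derive_coord//; exact: dh.
apply: (cont_diff_sum Vo) => i.
exact: (cont_diffM Vo (dhj i) (IH _ (cf _) ch0)).
Qed.

(** * Implicit functions *)

(** The sign change gives a zero by the intermediate value theorem and monotonicity makes it unique.
    For continuity, the signs of [phi] just below and just above [t a] persist for nearby parameters
    and trap the zero. *)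
Lemma implicit_monotone (R : realType) (T : topologicalType) (D : set T)
    (phi : T -> R -> R) (eta : R) : open D -> 0 < eta ->
  (forall a, D a -> forall s s', `|s| <= eta -> `|s'| <= eta -> s < s' ->
     phi a s < phi a s') ->
  (forall a, D a -> forall s, `|s| <= eta -> {for s, continuous (phi a)}) ->
  (forall s a, D a -> `|s| <= eta -> {for a, continuous (phi ^~ s)}) ->
  (forall a, D a -> phi a (- eta) < 0 < phi a eta) ->
  exists t : T -> R, forall a, D a ->
    [/\ `|t a| < eta, forall s, `|s| < eta -> (phi a s = 0 <-> s = t a)
      & {for a, continuous t}].
Proof.
move=> Do eta0 phi_incr phi_cs phi_ca phi_sign.
have nD a : D a -> \forall b \near a, D b.
  by move=> Da; move: Do; rewrite openE => /(_ a Da).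
have zero a : D a -> exists s, `|s| < eta /\ phi a s = 0.
  move=> Da; have /andP[sN sP] := phi_sign a Da.
  have [|||s] := @IVT R (phi a) (- eta) eta 0.
  - by lra.
  - apply: continuous_in_subspaceT => s.
    rewrite inE /= in_itv /= => /andP[s1 s2].
    by apply: phi_cs => //; rewrite ler_norml s1.
  - by rewrite ge_min (ltW sN) le_max (ltW sP) orbT.
  rewrite in_itv /= => /andP[s1 s2] s0; exists s; split=> //.
  rewrite ltr_norml !lt_neqAle s1 s2 !andbT; apply/andP; split.
    by apply: contraTneq sN => ->; rewrite s0 ltxx.
  by apply: contraTneq sP => <-; rewrite s0 ltxx.
(* The default value [0] is never returned for [a] in [D], where a zero exists. *)
pose t a := xget 0 [set s | `|s| < eta /\ phi a s = 0].
have tP a : D a -> `|t a| < eta /\ phi a (t a) = 0.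
  by move=> /zero[s sP]; rewrite /t; case: xgetP => [u _ //|/(_ s)].
have lt_t a s : D a -> `|s| <= eta -> phi a s < 0 -> s < t a.
  move=> Da s1 s0; have [/ltW t1 t0] := tP a Da; rewrite ltNge; apply/negP.
  rewrite le_eqVlt => /predU1P[ts|ts]; first by rewrite -ts t0 ltxx in s0.
  by have := phi_incr a Da _ _ t1 s1 ts; rewrite t0 ltNge (ltW s0).
have gt_t a s : D a -> `|s| <= eta -> 0 < phi a s -> t a < s.
  move=> Da s1 s0; have [/ltW t1 t0] := tP a Da; rewrite ltNge; apply/negP.
  rewrite le_eqVlt => /predU1P[ts|ts]; first by rewrite ts t0 ltxx in s0.
  by have := phi_incr a Da _ _ s1 t1 ts; rewrite t0 ltNge (ltW s0).
exists t => a Da; have [t1 t0] := tP a Da; split=> //.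
  move=> s s1; split=> [s0|->//]; apply/eqP; rewrite eq_le !leNgt.
  apply/andP; split; apply/negP => ts.
    by have := phi_incr a Da _ _ (ltW t1) (ltW s1) ts; rewrite t0 s0 ltxx.
  by have := phi_incr a Da _ _ (ltW s1) (ltW t1) ts; rewrite t0 s0 ltxx.
apply/cvgrPdist_lt => e e0.
(* Besides being at most [e], [d] must keep [t a - d] and [t a + d] within the range where [phi] is
   monotone. *)
have [d [d0 de deta]] : exists d, [/\ 0 < d, d <= e & `|t a| + d <= eta].
  exists (Num.min e (eta - `|t a|)); split.
  - by rewrite lt_min e0 subr_gt0.
  - by rewrite ge_min lexx.
  - by rewrite -lerBrDl ge_min lexx orbT.
have dm : `|t a - d| <= eta.
  by rewrite (le_trans (ler_normB _ _))// (gtr0_norm d0).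
have dp : `|t a + d| <= eta.
  by rewrite (le_trans (ler_normD _ _))// (gtr0_norm d0).
have phim : phi a (t a - d) < 0.
  by rewrite -t0; apply: phi_incr => //; [exact: ltW|rewrite ltrBlDr ltrDl].
have phip : 0 < phi a (t a + d).
  by rewrite -t0; apply: phi_incr => //; [exact: ltW|rewrite ltrDl].
near=> b.
have Db : D b by near: b; exact: nD.
have b1 : t a - d < t b.
  apply: lt_t => //; near: b.
  exact: cvgr_lt (phi_ca _ _ Da dm) _ phim.
have b2 : t b < t a + d.
  apply: gt_t => //; near: b.
  exact: cvgr_gt (phi_ca _ _ Da dp) _ phip.
rewrite distrC ltr_norml; apply/andP; split; lra.
Unshelve. all: by end_near. Qed.

Lemma derive_right_inverse (R : realType) m n (D : set 'rV[R]_m)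
    (h : 'rV[R]_m -> 'rV[R]_n) (C : 'M[R]_(n, m)) b a w :
  open D -> D a -> (forall a, D a -> h a *m C = a + b) -> differentiable h a ->
  'D_w h a *m C = w.
Proof.
move=> Do Da hC dh; rewrite -[LHS](derive_linear (mulmxr C) w dh).
rewrite -(@near_eq_derive _ _ _ (id + cst b)).
  by rewrite deriveD// derive_id derive_cst addr0.
by apply: filterS (open_nbhs_nbhs (conj Do Da)) => z /hC.
Qed.

Section ImplicitGraph.
Context {R : realType} {m n : nat} (U : set 'rV[R]_n) (g : 'rV[R]_n -> R)
  (x : 'rV[R]_n) (B : 'M[R]_(m, n)) (e : 'rV[R]_n)
  (C : 'M[R]_(n, m)) (c : 'cV[R]_n).
Hypotheses (Uo : open U) (Ux : U x) (g_smooth : forall r, cont_diff r U g)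
  (gx : g x = 0) (ge : 0 < 'D_e g x)
  (BC : B *m C = 1%:M) (eC : e *m C = 0)
  (split_rV : forall y : 'rV[R]_n, y = y *m C *m B + (y *m c) 0 0 *: e).

(** Coordinates centred at [x]: [a] along the rows of [B], read back by [C], and [s] along [e], a
    direction in which [g] increases at [x]. *)
Let pt (a : 'rV[R]_m) (s : R) := s *: e + (a *m B + x).

Let mulmx_cont p q (A : 'M[R]_(p, q)) : continuous (fun a : 'rV[R]_p => a *m A).
Proof. exact: (@rV_linear_continuous _ _ _ (mulmxr A)). Qed.

(** By continuity ['D_e g] stays positive near [x], so [g] is strictly increasing on short segments
    parallel to [e], and [implicit_monotone] applies to [g (pt a s)]. *)
Lemma implicit_exists : exists delta eta (t : 'rV[R]_m -> R),
  [/\ 0 < delta, 0 < eta & forall a, `|a| < delta ->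
    [/\ `|t a| < eta,
        forall s, `|s| < eta -> [/\ U (pt a s), 0 < 'D_e g (pt a s)
          & g (pt a s) = 0 <-> s = t a]
      & {for a, continuous t}]].
Proof.
have [dg cg1] := g_smooth 2.
have dge : {for x, continuous (fun y => 'D_e g y)}.
  by apply: differentiable_continuous; have [+ _] := cg1 e; apply.
have : \forall y \near x, U y /\ 0 < 'D_e g y.
  near=> y; split; near: y; last exact: cvgr_gt dge _ ge.
  exact: open_nbhs_nbhs.
move=> /nbhs_ballP[rho /= rho0 Hrho].
have Bc : continuous (mulmxr B : 'rV[R]_m -> 'rV[R]_n).
  exact: rV_linear_continuous.
have [K K0 BK] := linear_lipschitz Bc.
(* [eta] and [d0] each use half of the radius [rho], for the displacements [s *: e] and [a *m B];
   adding [1] keeps the divisor visibly positive. *)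
pose eta := rho / 2 / (`|e| + 1).
have e1 : 0 < `|e| + 1 by rewrite ltr_wpDl.
have eta0 : 0 < eta by rewrite !divr_gt0.
pose d0 := rho / 2 / K.
have d00 : 0 < d0 by rewrite !divr_gt0.
have ptU a s : `|a| < d0 -> `|s| <= eta -> U (pt a s) /\ 0 < 'D_e g (pt a s).
  move=> ad se; apply: Hrho; rewrite -ball_normE /=.
  rewrite distrC /pt addrA addrK (le_lt_trans (ler_normD _ _))//.
  rewrite (splitr rho) ler_ltD//.
    rewrite normrZ (le_trans (ler_pM _ _ se (lexx _)))//.
    rewrite /eta mulrAC ler_pdivrMr// ler_pM2l ?divr_gt0//.
    by rewrite lerDl.
  by rewrite (le_lt_trans (BK _))// mulrC -ltr_pdivlMr.
have ptD a s : `|a| < d0 -> `|s| <= eta -> derivable g (pt a s) e.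
  by move=> ad /(ptU _ _ ad)[pU _]; apply: diff_derivable; exact: dg.
have g_cs a s : `|a| < d0 -> `|s| <= eta ->
    {for s, continuous (fun s => g (pt a s))}.
  move=> ad se; have [Dg _] := is_derive_line (ptD _ _ ad se).
  by apply: differentiable_continuous; apply/derivable1_diffP.
have g_incr a s s' : `|a| < d0 -> `|s| <= eta -> `|s'| <= eta -> s < s' ->
    g (pt a s) < g (pt a s').
  move=> ad se s'e ss'.
  have between u : s <= u -> u <= s' -> `|u| <= eta.
    move: se s'e; rewrite !ler_norml => /andP[h1 _] /andP[_ h2] h3 h4.
    by rewrite (le_trans h1)// (le_trans h4).
  have [u uss' E] : exists2 u, u \in `]s, s'[ &
      g (pt a s') - g (pt a s) = 'D_e g (pt a u) * (s' - s).
    apply: (MVT (f := fun s => g (pt a s))) => // [u|].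
      rewrite in_itv /= => /andP[/ltW h1 /ltW h2].
      by apply: is_derive_line; apply: ptD => //; exact: between.
    apply: continuous_in_subspaceT => u.
    rewrite inE /= in_itv /= => /andP[h1 h2].
    by apply: g_cs => //; exact: between.
  rewrite -subr_gt0 E mulr_gt0 ?subr_gt0//.
  move: uss'; rewrite in_itv /= => /andP[/ltW h1 /ltW h2].
  by have [] := ptU a u ad (between _ h1 h2).
have g_ca s a : `|a| < d0 -> `|s| <= eta ->
    {for a, continuous (fun a => g (pt a s))}.
  move=> ad se; apply: continuous_comp.
    apply: continuousD; first exact: cst_continuous.
    by apply: continuousD; [exact: mulmx_cont|exact: cst_continuous].
  by apply: differentiable_continuous; apply: dg; have [] := ptU a s ad se.
have norm00 : `|0 : 'rV[R]_m| < d0 by rewrite normr0.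
have g00 : g (pt 0 0) = 0 by rewrite /pt scale0r mul0mx !add0r.
have eta_norm : `|eta| <= eta by rewrite gtr0_norm.
have eta_normN : `|- eta| <= eta by rewrite normrN.
(* As [g] vanishes at [pt 0 0 = x], monotonicity gives the signs at both ends over [a = 0];
   continuity in [a] spreads them over a ball of radius [d1]. *)
have gP : 0 < g (pt 0 eta).
  by rewrite -g00; apply: g_incr; rewrite ?normr0// ltW.
have gN : g (pt 0 (- eta)) < 0.
  by rewrite -g00; apply: g_incr; rewrite ?normr0 ?oppr_lt0// ltW.
have : \forall a \near (0 : 'rV[R]_m), g (pt a (- eta)) < 0 < g (pt a eta).
  near=> a; apply/andP; split; near: a.
    exact: cvgr_lt (g_ca _ _ norm00 eta_normN) _ gN.
  exact: cvgr_gt (g_ca _ _ norm00 eta_norm) _ gP.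
move=> /nbhs_ballP[d1 /= d10 Hd1].
pose delta := Num.min d0 d1.
have delta0 : 0 < delta by rewrite lt_min d00 d10.
have deltaP (a : 'rV[R]_m) : ball (0 : 'rV[R]_m) delta a ->
    `|a| < d0 /\ ball (0 : 'rV[R]_m) d1 a.
  rewrite -!ball_normE /= !sub0r !normrN lt_min => /andP[-> ->].
  by [].
have [||a Da s s'|a Da s|s a Da|a Da|t tP] := @implicit_monotone R 'rV[R]_m
  (ball (0 : 'rV[R]_m) delta) (fun a s => g (pt a s)) eta => //.
- exact: ball_open.
- by apply: g_incr; have [] := deltaP a Da.
- by apply: g_cs; have [] := deltaP a Da.
- by apply: g_ca; have [] := deltaP a Da.
- by apply: Hd1; have [] := deltaP a Da.
exists delta, eta, t; split=> // a ad.
have Da : ball (0 : 'rV[R]_m) delta a by rewrite -ball_normE /= sub0r normrN.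
have [t1 t2 t3] := tP a Da; split=> // s s1.
have [ad0 _] := deltaP a Da; have [? ?] := ptU a s ad0 (ltW s1).
by split=> //; exact: t2.
Unshelve. all: by end_near. Qed.

(** A bootstrap: a continuous solution is first shown differentiable; its derivative is then a
    rational expression in derivatives of [g] composed with [h], so class [r] of [h] yields class
    [r + 1]. *)
Lemma implicit_lift_smooth (D : set 'rV[R]_m) (h : 'rV[R]_m -> 'rV[R]_n) r :
  open D -> (forall a, D a -> {for a, continuous h}) ->
  (forall a, D a -> [/\ U (h a), 0 < 'D_e g (h a), g (h a) = 0
    & h a *m C = a + x *m C]) ->
  cont_diff_on r D h.
Proof.
move=> Do ch hP.
have nearD a : D a -> \forall b \near a, D b.
  by move=> Da; move: Do; rewrite openE => /(_ a Da).
have dg y : U y -> differentiable g y by have [+ _] := g_smooth 1; apply.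
have dh a : D a -> differentiable h a.
  move=> Da; have [Uh hge _ _] := hP a Da.
  (* [Phi] straightens [g = 0]: it is an immersion and [Phi \o h] is affine. *)
  pose Phi (y : 'rV[R]_n) := y *m (C *m B) + g y *: e.
  have PhiE : is_diff (h a) Phi (fun v => v *m (C *m B) + 'd g (h a) v *: e).
    have D1 : is_diff (h a) (fun y : 'rV[R]_n => y *m (C *m B))
        (mulmxr (C *m B)).
      have Lc := @rV_linear_continuous _ _ _ (mulmxr (C *m B)).
      split; first exact: (linear_differentiable (f := mulmxr (C *m B))).
      exact: (diff_lin (f := mulmxr (C *m B))).
    have D2 : is_diff (h a) (fun y => g y *: e) (fun v => 'd g (h a) v *: e).
      by split; [apply: differentiableZl; exact: dg|apply: diffZl; exact: dg].
    exact: (is_diffD (f := fun y : 'rV[R]_n => y *m (C *m B)) D1 D2).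
  apply: (diff_lift (F := Phi)) => //; last 2 first.
  - exact: ch.
  - apply: (@near_eq_differentiable _ _ _
      ((fun b : 'rV[R]_m => b *m B) + cst (x *m C *m B))).
      near=> b; rewrite /= /Phi.
      have [|_ _ -> hC] := hP b; first by near: b; exact: nearD.
      by rewrite !fctE mulmxA hC mulmxDl scale0r addr0.
    apply: differentiableD => //.
    by apply: (linear_differentiable (f := mulmxr B)); exact: mulmx_cont.
  (* If the differential of [Phi] kills [v], then [v *m C = 0], so [v] is a multiple of [e], and
     ['D_e g] is nonzero. *)
  apply: inj_row_free => v.
  have [_ dPhi] := PhiE; rewrite mul_rV_lin1 dPhi => v0.
  have vC : v *m C = 0.
    have := congr1 (mulmx^~ C) v0.
    rewrite mulmxDl -scalemxAl eC scaler0 addr0 mul0mx.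
    by rewrite -!mulmxA BC mulmx1.
  move: v0; rewrite mulmxA vC mul0mx add0r (split_rV v) vC mul0mx add0r.
  rewrite linearZ /= -deriveE; last exact: dg.
  move=> /eqP; rewrite scaler_eq0 => /orP[|/eqP ->]; last by rewrite scaler0.
  by rewrite mulf_eq0 (gt_eqF hge) orbF => /eqP ->; rewrite scale0r.
(* Implicit differentiation: the derivative [k] satisfies [k *m C = w] and ['D_k g (h a) = 0], which
   fix its components along [B] and along [e]. *)
have dhE w a j : D a -> 'D_w h a 0 j = (w *m B) 0 j +
    -1 * (('D_(w *m B) g \o h) a * (('D_e g \o h) a)^-1) * e 0 j.
  move=> Da; have [Uh hge _ _] := hP a Da.
  set k := 'D_w h a.
  have kC : k *m C = w.
    apply: (derive_right_inverse (b := x *m C) w Do Da _ (dh a Da)).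
    by move=> b /hP[].
  have gk : 'D_k g (h a) = 0.
    rewrite /k -derive_comp; [|exact: dh|exact: dg].
    rewrite -(@near_eq_derive _ _ _ (cst 0)) ?derive_cst//.
    near=> b; rewrite /=.
    by have [|_ _ -> _] := hP b; first by near: b; exact: nearD.
  have kE : k = w *m B + (k *m c) 0 0 *: e by rewrite [LHS]split_rV kC.
  move: gk; rewrite deriveE; last exact: dg.
  rewrite kE linearD linearZ /= -!deriveE; [|exact: dg|exact: dg].
  move: ((k *m c) 0 0) => q /eqP; rewrite addrC addr_eq0 => /eqP E.
  rewrite !mxE; congr (_ + _ * _); rewrite -[q](mulfK (lt0r_neq0 hge)).
  by rewrite -[q * _]/(q *: _) E mulN1r mulNr.
elim: r => [|r IH]; first exact: ch.
split; first exact: dh.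
move=> w; apply/(cont_diff_onP Do) => j.
have [_ cg] := g_smooth r.+1.
have hU a : D a -> U (h a) by move=> /hP[].
apply: (@cont_diff_ext _ _ _ Do _ (fun a => (w *m B) 0 j +
    -1 * (('D_(w *m B) g \o h) a * (('D_e g \o h) a)^-1) * e 0 j)).
  by move=> a Da; rewrite dhE.
apply: (cont_diffD Do (cont_diff_cst Do _ _)).
apply: (cont_diffM Do _ (cont_diff_cst Do _ _)).
apply: (cont_diffM Do (cont_diff_cst Do _ _)).
apply: (cont_diffM Do (cont_diff_comp Uo Do hU (cg _) IH)).
apply: (cont_diffV Do _ (cont_diff_comp Uo Do hU (cg _) IH)) => a Da.
by have [_ hge _ _] := hP a Da; rewrite /= gt_eqF.
Unshelve. all: by end_near. Qed.

End ImplicitGraph.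

(** * Comparison of parametrisations *)

(** This and the next three lemmas pass from [F] to the scalar coordinates of [F *m N], to which the
    results on critical points apply. *)
Lemma derive_mulmx_coord (R : realType) (V : normedModType R) m p
    (F : V -> 'rV[R]_m) (N : 'M[R]_(m, p)) j y w : differentiable F y ->
  'D_w (fun z => (F z *m N) 0 j) y = ('D_w F y *m N) 0 j.
Proof.
move=> dF; have Nc := @rV_linear_continuous _ _ _ (mulmxr N).
rewrite -(derive_coord (F := mulmxr N \o F)).
  by rewrite (derive_linear (mulmxr N) w dF).
by apply: differentiable_comp => //; exact: linear_differentiable.
Qed.

Lemma differentiable_mulmx_coord (R : realType) (V : normedModType R) m p
    (F : V -> 'rV[R]_m) (N : 'M[R]_(m, p)) j y : differentiable F y ->
  differentiable (fun z => (F z *m N) 0 j) y.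
Proof.
move=> dF; have Nc := @rV_linear_continuous _ _ _ (mulmxr N).
have dNF : differentiable (mulmxr N \o F) y.
  by apply: differentiable_comp => //; exact: linear_differentiable.
by have /differentiable_rVP := dNF; apply.
Qed.

Lemma derive2_mulmx_coord (R : realType) (V : normedModType R) m p
    (F : V -> 'rV[R]_m) (N : 'M[R]_(m, p)) j y w :
  (\forall z \near y, differentiable F z) ->
  differentiable (fun z => 'D_w F z) y ->
  'D_w (fun z => 'D_w (fun z => (F z *m N) 0 j) z) y =
    ('D_w (fun z => 'D_w F z) y *m N) 0 j.
Proof.
move=> ndF d2F; rewrite -derive_mulmx_coord//; apply: near_eq_derive.
by near=> z; rewrite derive_mulmx_coord//; near: z.
Unshelve. all: by end_near. Qed.

Lemma differentiable_derive_mulmx_coord (R : realType) (V : normedModType R) m p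
    (F : V -> 'rV[R]_m) (N : 'M[R]_(m, p)) j y w :
  (\forall z \near y, differentiable F z) ->
  differentiable (fun z => 'D_w F z) y ->
  differentiable (fun z => 'D_w (fun z => (F z *m N) 0 j) z) y.
Proof.
move=> ndF d2F.
apply: (near_eq_differentiable _ (differentiable_mulmx_coord N j d2F)).
by near=> z; rewrite derive_mulmx_coord//; near: z.
Unshelve. all: by end_near. Qed.

Lemma smooth_on_differentiable (R : realType) n m (U : set 'rV[R]_n)
    (F : 'rV[R]_n -> 'rV[R]_m) x : open U -> U x -> smooth_on U F ->
  (\forall y \near x, differentiable F y) /\
  (forall v, differentiable (fun y => 'D_v F y) x).
Proof.
move=> Uo Ux sF; have [dF cF] := sF 2.
split=> [|v]; last by have [+ _] := cF v; apply.
by apply: filterS (open_nbhs_nbhs (conj Uo Ux)) => y; exact: dF.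
Qed.

Section CompareParam.
Context {R : realType} {n n' m : nat} {M : topologicalType}.
Variables (iota : M -> 'rV[R]_m) (A : set M) (p : M).
Variables (U : set 'rV[R]_n) (phi : 'rV[R]_n -> M) (x : 'rV[R]_n).
Variables (V : set 'rV[R]_n') (psi : 'rV[R]_n' -> M) (y : 'rV[R]_n').
Hypotheses (Fp : local_param iota setT p U phi x)
  (Gp : local_param iota A p V psi y).
Let F := iota \o phi.
Let G := iota \o psi.

(** [h] is [psi] followed by the inverse of [phi]. As [phi] parametrises an open part of the whole
    of [M], nearby points of [A] lie in its image, and openness of [phi] gives continuity of [h] at
    [y]. *)
Lemma local_param_transition : exists h : 'rV[R]_n' -> 'rV[R]_n,
  [/\ h y = x, {for y, continuous h} & {near y, F \o h =1 G}].
Proof.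
have [[Uo Ux] phix [phic phi_inj phi_open] _ _] := Fp.
have [[Vo Vy] psiy [psic _ _] _ _] := Gp.
(* Injectivity of [phi] on [U] makes the choice unique; the default [x] concerns only points with
   [psi z] outside the image of [U]. *)
pose h z := xget x [set a | U a /\ phi a = psi z].
have hE z a : U a -> phi a = psi z -> h z = a.
  move=> Ua az; rewrite /h; case: xgetP => [b _ [Ub bz]|/(_ a)[]//].
  by apply: phi_inj; rewrite ?inE// bz az.
have near_preim (N : set 'rV[R]_n) : open N -> N x ->
    \forall z \near y, exists2 a, (U `&` N) a & phi a = psi z.
  move=> No Nx; have UNo : open (U `&` N) by exact: openI.
  have [W Wo] := phi_open _ UNo (@subIsetl _ U N).
  rewrite setTI => WE.
  have : \forall z \near y, W (psi z).
    apply: (psic y Vy W); apply: open_nbhs_nbhs; split=> //.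
    by rewrite psiy -WE; exists x.
  by apply: filterS => z; rewrite -WE => -[a UNa az]; exists a.
exists h; split.
- by apply: hE => //; rewrite phix psiy.
- move=> N; have -> : h y = x by apply: hE => //; rewrite phix psiy.
  rewrite nbhsE => -[N' [No Nx] N'N].
  apply: filterS (near_preim N' No Nx) => z [a [Ua N'a] az].
  by apply: N'N; rewrite (hE _ _ Ua az).
- apply: filterS (near_preim setT openT I) => z [a [Ua _] az].
  by rewrite /F /G /= (hE _ _ Ua az) az.
Qed.

(** The transition map is differentiable by [diff_lift], and [v] is its derivative along [w]. Modulo
    the tangent space, the coordinates of [F] are critical at [x], so [critical_derive2_comp]
    equates the accelerations there. *)
Lemma local_param_compare w : exists v,
  'D_v F x = 'D_w G y /\
  ('D_v (fun z => 'D_v F z) x - 'D_w (fun z => 'D_w G z) y <= 'J F x)%MS.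
Proof.
have [h [hy hc FhG]] := local_param_transition.
have [[Uo Ux] _ _ Fs Ffree] := Fp.
have [[Vo Vy] _ _ Gs _] := Gp.
have [ndF d2F] := smooth_on_differentiable Uo Ux Fs.
have [ndG d2G] := smooth_on_differentiable Vo Vy Gs.
have dF := nbhs_singleton ndF; have dG := nbhs_singleton ndG.
have GFh : {near y, G =1 F \o h} by apply: filterS FhG.
have dh : differentiable h y.
  apply: (diff_lift (F := F)) => //; rewrite ?hy//; first exact: Ffree.
  exact: near_eq_differentiable GFh dG.
have dFh : differentiable F (h y) by rewrite hy.
exists ('D_w h y); split.
  by rewrite -(near_eq_derive w FhG) (derive_comp w dh dFh) hy.
(* Multiplication by [N] kills exactly the row space of ['J F x], so each coordinate of [F *m N] has
   vanishing first derivative at [x]. *)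
set v := 'D_w h y; pose N := cokermx ('J F x).
suff key : 'D_v (fun z => 'D_v F z) x *m N = 'D_w (fun z => 'D_w G z) y *m N.
  by rewrite submxE mulmxBl subr_eq0; apply/eqP; exact: key.
apply/rowP => j.
apply: etrans (esym (derive2_mulmx_coord N j ndF (d2F v))) _.
apply: etrans (derive2_mulmx_coord N j ndG (d2G w)).
pose f z := (F z *m N) 0 j; pose g z := (G z *m N) 0 j.
have ndf : \forall z \near h y, differentiable f z.
  by rewrite hy; apply: filterS ndF => z; exact: differentiable_mulmx_coord.
have d2f u : differentiable (fun z => 'D_u f z) (h y).
  by rewrite hy; exact: differentiable_derive_mulmx_coord.
have ndg : \forall z \near y, differentiable g z.
  by apply: filterS ndG => z; exact: differentiable_mulmx_coord.
have d2g u : differentiable (fun z => 'D_u g z) y.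
  exact: differentiable_derive_mulmx_coord.
have df0 u : 'D_u f (h y) = 0.
  rewrite hy derive_mulmx_coord// deriveEjacobian// -mulmxA mulmx_coker.
  by rewrite mulmx0 mxE.
have fhg : {near y, f \o h =1 g} by apply: filterS FhG => z E; rewrite /g -E.
have := critical_derive2_comp w ndf d2f ndg d2g df0 dh fhg.
by rewrite hy => /esym.
Qed.

(** The product of [G] with [u] is constant on the open set [V], so its first and second derivatives
    vanish. *)
Lemma derive_normal_section_orth (u : 'rV[R]_m) w :
  A `<=` normal_section iota p u ->
  'D_w G y *m u^T = 0 /\ 'D_w (fun z => 'D_w G z) y *m u^T = 0.
Proof.
move=> Au; have [[Vo Vy] _ [_ _ psi_open] Gs _] := Gp.
have [dG _] := Gs 1.
have [ndG d2G] := smooth_on_differentiable Vo Vy Gs.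
have [W _ VW] := psi_open V Vo (@subset_refl _ V).
have nearV z : V z -> \forall z' \near z, V z'.
  by move=> Vz; exact: open_nbhs_nbhs.
have GuE z : V z -> (G z *m u^T) 0 0 = (iota p *m u^T) 0 0.
  move=> Vz; have [Az _] : (A `&` W) (psi z) by rewrite -VW; exists z.
  have := Au _ Az; rewrite /normal_section /= edotE mulmxBl mxE [X in _ + X]mxE.
  by move=> /eqP; rewrite subr_eq0 => /eqP.
have dGu z : V z -> ('D_w G z *m u^T) 0 0 = 0.
  move=> Vz; rewrite -derive_mulmx_coord; last exact: dG.
  rewrite (@near_eq_derive _ _ _ _ (cst ((iota p *m u^T) 0 0))).
    by rewrite derive_cst.
  by apply: filterS (nearV z Vz) => z' /GuE.
split; apply/matrixP => i j; rewrite !ord1 [RHS]mxE; first exact: dGu.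
rewrite -derive_mulmx_coord//.
rewrite (@near_eq_derive _ _ _ _ (cst 0)); first by rewrite derive_cst.
by apply: filterS (nearV y Vy) => z' /dGu.
Qed.

End CompareParam.

(** The first claim feeds the comparison of accelerations into [normal_projection_eq]. For the
    second, a tangent vector is a sum of a vector tangent to the section and a multiple of [u], and
    orthogonality to [u] removes the latter. *)
Lemma second_fundamental_form_section (R : realType) n m (M : topologicalType)
    (iota : M -> 'rV[R]_m) (p : M) (u : 'rV[R]_m)
    (U : set 'rV[R]_n.+1) (phi : 'rV[R]_n.+1 -> M) x
    (V : set 'rV[R]_n) (psi : 'rV[R]_n -> M) y :
  local_param iota setT p U phi x ->
  local_param iota (normal_section iota p u) p V psi y ->
  (u <= 'J (iota \o phi) x)%MS -> u != 0 ->
  (forall w, exists v, 'd (iota \o phi) x v = 'd (iota \o psi) y w /\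
    second_fundamental_form 1%:M (iota \o phi) x v v =
    second_fundamental_form (orth u) (iota \o psi) y w w) /\
  (forall v, edot ('d (iota \o phi) x v) u = 0 ->
    exists w, 'd (iota \o psi) y w = 'd (iota \o phi) x v).
Proof.
move=> Fp Gp uT u0.
set F := iota \o phi in uT *; set G := iota \o psi.
have [[Uo Ux] _ _ Fs Ffree] := Fp.
have [[Vo Vy] _ _ Gs Gfree] := Gp.
have dF : differentiable F x by have [+ _] := Fs 1; apply.
have dG : differentiable G y by have [+ _] := Gs 1; apply.
have comp w := local_param_compare Fp Gp w.
have norm w := derive_normal_section_orth Gp w (@subset_refl _ _).
have ST : ('J G y <= 'J F x)%MS.
  apply/rV_subP => z /submxP[w ->]; have [v [vw _]] := comp w.
  by rewrite -deriveEjacobian// -vw deriveEjacobian// submxMl.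
have Su : 'J G y *m u^T = 0.
  apply/row_matrixP => i; rewrite row0 rowE mulmxA -deriveEjacobian//.
  by have [] := norm (delta_mx 0 i).
split=> [w|v vu].
  have [v [vw D2]] := comp w; exists v; split; first by rewrite -!deriveE.
  have [_ D2u] := norm w.
  exact: (normal_projection_eq (Ffree x Ux) (Gfree y Vy) ST uT u0 Su D2u D2).
suff /submxP[w wE] : ('d F x v <= 'J G y)%MS.
  by exists w; rewrite -[LHS](mul_rV_lin1 ('d G y)) wE.
have vT : ('d F x v <= 'J F x)%MS by rewrite -(mul_rV_lin1 ('d F x)) submxMl.
have /sub_addsmxP[[a b] /= vE] := submx_trans vT
  (hyperplane_add_normal (Ffree x Ux) (Gfree y Vy) ST uT u0 Su).
have bu0 : b *m u = 0.
  apply: mulmx_gram_eq0; move/eqP: vu; rewrite edot_eq0 vE mulmxDl.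
  by rewrite -mulmxA Su mulmx0 add0r mulmxA => /eqP.
by rewrite vE bu0 addr0 submxMl.
Qed.

(** * Parametrisation of the normal section *)

(** [e] is completed to a basis by the rows of [B]; the columns of the inverse of the basis matrix
    give the coordinates, [c] along [e] and [C] along [B]. *)
Lemma complement_coordinates (R : fieldType) n (e : 'rV[R]_n.+1) : e != 0 ->
  exists (B : 'M[R]_(n, n.+1)) (C : 'M[R]_(n.+1, n)) (c : 'cV[R]_n.+1),
    [/\ B *m C = 1%:M, e *m C = 0, B *m c = 0, e *m c = 1%:M &
        forall y : 'rV[R]_n.+1, y = y *m C *m B + (y *m c) 0 0 *: e].
Proof.
move=> e0.
have [B BE] : exists B : 'M[R]_(n, n.+1), (B :=: e^C)%MS.
  have := eq_row_base (e^C)%MS; move: (row_base _).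
  by rewrite mxrank_compl rank_rV e0 subn1 => B; exists B.
pose P : 'M[R]_n.+1 := col_mx e B.
have Pu : P \in unitmx.
  have : ((1%:M : 'M[R]_n.+1) <= col_mx e B)%MS.
    rewrite -addsmxE (adds_eqmx (eqmx_refl e) BE) sub1mx.
    exact: addsmx_compl_full.
  by rewrite -row_full_unit -sub1mx.
pose Q : 'M[R]_(n.+1, 1 + n) := invmx P.
exists B, (rsubmx Q), (lsubmx Q).
have : col_mx e B *m Q = 1%:M by exact: mulmxV.
rewrite -[Q in LHS]hsubmxK mul_col_row (scalar_mx_block 1 n).
move=> /eq_block_mx[ec eC Bc BC]; split=> // y.
have : y *m (Q *m col_mx e B) = y by rewrite (mulVmx Pu) mulmx1.
rewrite -[Q in LHS]hsubmxK mul_row_col mulmxDr !mulmxA => {1}<-.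
by rewrite addrC {1}[y *m lsubmx Q]mx11_scalar mul_scalar_mx.
Qed.

(** In the chart [phi] the section is the zero set of [g], which is regular at [x] because [u] is a
    non-zero tangent vector. The implicit function theorem presents it as a graph [h], and
    [phi \o h] is the parametrisation. *)
Lemma normal_section_param (R : realType) n m (M : topologicalType)
    (iota : M -> 'rV[R]_m) (p : M) (u : 'rV[R]_m)
    (U : set 'rV[R]_n.+1) (phi : 'rV[R]_n.+1 -> M) x :
  local_param iota setT p U phi x -> (u <= 'J (iota \o phi) x)%MS -> u != 0 ->
  exists (V : set 'rV[R]_n) (psi : 'rV[R]_n -> M) y,
    local_param iota (normal_section iota p u) p V psi y.
Proof.
move=> Fp; set F := iota \o phi => /submxP[e uE] u0.
have [[Uo Ux] phix [phic phi_inj phi_open] Fs Ffree] := Fp.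
have [dF _] := Fs 1.
have e0 : e != 0 by apply: contraNneq u0 => e0; rewrite uE e0 mul0mx.
have [B [C [c [BC eC Bc ec splitE]]]] := complement_coordinates e0.
pose g y := edot (F y - iota p) u.
have gs r : cont_diff r U g.
  apply: (cont_diff_sum Uo) => j.
  apply: (cont_diffM Uo _ (cont_diff_cst Uo _ _)).
  apply: (@cont_diff_ext _ _ _ Uo _ (fun y => F y 0 j + - iota p 0 j)).
    by move=> y _; rewrite !mxE.
  apply: (cont_diffD Uo _ (cont_diff_cst Uo _ _)).
  by have /(cont_diff_onP Uo) := Fs r; apply.
have gx : g x = 0.
  by rewrite /g /F /= phix subrr /edot big1// => j _; rewrite mxE mul0r.
(* Since [u = e *m 'J F x], this derivative is [edot u u]. *)
have ge : 0 < 'D_e g x.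
  have gE : g = (fun y => (F y *m u^T) 0 0) + cst (- (iota p *m u^T) 0 0).
    apply/funext => y; rewrite /g edotE mulmxBl mxE [X in _ + X]mxE.
    by rewrite !fctE.
  have dg1 : differentiable (fun y => (F y *m u^T) 0 0) x.
    by apply: differentiable_mulmx_coord; exact: dF.
  rewrite gE deriveD//; last exact: diff_derivable.
  rewrite derive_cst addr0 derive_mulmx_coord; last exact: dF.
  rewrite deriveEjacobian; last exact: dF.
  by rewrite -uE -edotE lt0r edot_self_eq0 u0 edot_ge0.
have [delta [eta [t [delta0 eta0 tP]]]] := implicit_exists B Uo Ux gs gx ge.
pose V : set 'rV[R]_n := ball 0 delta.
have Vo : open V by exact: ball_open.
have Vnorm a : V a -> `|a| < delta.
  by rewrite /V -ball_normE /= sub0r normrN.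
pose h a := t a *: e + (a *m B + x).
have hP a : V a -> [/\ U (h a), 0 < 'D_e g (h a), g (h a) = 0
    & h a *m C = a + x *m C].
  move=> /Vnorm/tP[ta tU _]; have [Uh hge gh] := tU _ ta.
  split=> //; first by apply/gh.
  by rewrite /h !mulmxDl -scalemxAl eC scaler0 add0r -mulmxA BC mulmx1.
have Bcont : continuous (mulmxr B : 'rV[R]_n -> 'rV[R]_n.+1).
  exact: rV_linear_continuous.
have hc a : V a -> {for a, continuous h}.
  move=> /Vnorm/tP[_ _ tc]; apply: continuousD.
    exact: continuousZr_tmp.
  by apply: continuousD; [exact: Bcont|exact: cst_continuous].
have hs r : cont_diff_on r V h.
  exact: (implicit_lift_smooth Uo gs BC eC splitE r Vo hc hP).
have hinj a b : V a -> V b -> h a = h b -> a = b.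
  move=> /hP[_ _ _ ha] /hP[_ _ _ hb] hab.
  by apply: (addIr (x *m C)); rewrite -ha -hb hab.
have V0 : V 0 by exact: ballxx.
have h0 : h 0 = x.
  have [_ tU _] := tP 0 (Vnorm _ V0).
  have [|_ _ [+ _]] := tU 0; first by rewrite normr0.
  rewrite /h mul0mx scale0r !add0r => /(_ gx) <-.
  by rewrite scale0r add0r.
have hU a : V a -> U (h a) by move=> /hP[].
have dh a : V a -> differentiable h a by have [+ _] := hs 1; apply.
exists V, (phi \o h), 0; split=> //.
- by rewrite /= h0.
- split.
  + by move=> a Va; apply: continuous_comp; [exact: hc|exact/phic/hU].
  + move=> a b; rewrite !inE => Va Vb /phi_inj hab.
    by apply: hinj => //; apply: hab; rewrite inE; exact: hU.
  + move=> V' V'o V'V.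
    (* The open box of points with coordinates in [V'] along [B] and below [eta] in absolute value
       along [e]: within it the zeros of [g] are exactly the graph of [h] over [V']. *)
    pose N := (fun y : 'rV[R]_n.+1 => (y - x) *m C) @^-1` V' `&`
      (fun y : 'rV[R]_n.+1 => `|((y - x) *m c) 0 0|) @^-1` [set r | r < eta].
    have No : open (U `&` N).
      have shiftc (q : nat) (D : 'M[R]_(n.+1, q)) :
          continuous (fun y : 'rV[R]_n.+1 => (y - x) *m D).
        move=> y; apply: (continuous_comp (f := fun y : 'rV[R]_n.+1 => y - x)
          (g := mulmxr D)).
          by apply: continuousB => //; exact: cst_continuous.
        exact: (@rV_linear_continuous _ _ _ (mulmxr D)).
      apply: openI => //; apply: openI.
        by apply: open_comp V'o => y _; exact: shiftc.
      apply: open_comp; last exact: open_lt.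
      move=> y _; apply: (continuous_comp (g := fun r : R => `|r|)); last first.
        exact: norm_continuous.
      apply: (continuous_comp (g := fun v : 'rV[R]_1 => v 0 0)).
        exact: shiftc.
      exact: coord_continuous.
    have [W Wo] := phi_open _ No (@subIsetl _ U N).
    rewrite setTI => WE; exists W => //; rewrite -WE.
    rewrite eqEsubset; split=> [q [a V'a <-]|q [Aq [y [Uy [V'y cy]] yq]]].
      have [ta _ _] := tP a (Vnorm _ (V'V _ V'a)).
      have [Uh _ gh _] := hP a (V'V _ V'a).
      split; first exact: gh.
      exists (h a) => //; split=> //; rewrite /N /= /h addrA addrK mulmxDl.
      rewrite -scalemxAl eC scaler0 add0r -mulmxA BC mulmx1; split=> //.
      by rewrite mulmxDl -scalemxAl ec -mulmxA Bc mulmx0 addr0 !mxE mulr1.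
    have Va := V'V _ V'y; exists ((y - x) *m C) => //=.
    have yE : ((y - x) *m c) 0 0 *: e + ((y - x) *m C *m B + x) = y.
      by rewrite addrA [X in X + _]addrC -splitE subrK.
    have [_ tU _] := tP _ (Vnorm _ Va); have [_ _ [+ _]] := tU _ cy.
    by rewrite yE /h /g /F /= yq => /(_ Aq) <-; rewrite yE yq.
- move=> r; apply/(cont_diff_onP Vo) => j.
  apply: (cont_diff_comp (f := fun y => F y 0 j) Uo Vo hU) => //.
  by have /(cont_diff_onP Uo) := Fs r; apply.
- move=> a Va; apply: inj_row_free => v.
  have dFha : differentiable F (h a) by apply: dF; exact: hU.
  have dFh : differentiable (F \o h) a.
    by apply: differentiable_comp => //; exact: dh.
  (* [F] is an immersion, and [h] followed by [C] is a translation, so both differentials are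
     injective. *)
  rewrite -[v *m _](deriveEjacobian v dFh) (derive_comp v (dh a Va) dFha).
  rewrite deriveEjacobian//.
  move=> vJ; have Dh0 : 'D_v h a = 0.
    by apply: (row_free_inj (Ffree _ (hU a Va))); rewrite vJ mul0mx.
  have hC b : V b -> h b *m C = b + x *m C by move=> /hP[].
  by rewrite -(derive_right_inverse v Vo Va hC (dh a Va)) Dh0 mul0mx.
Qed.

(** * The curvature locus as the union of the curvature ellipses *)

Theorem theorem3p1 (R : realType) (k : nat) (hk : (0 < k)%N)
    (M : topologicalType) (iota : M -> 'rV[R]_(3 + k))
    (hM : regular_manifold 3 iota) (p : M) :
  curvature_locus iota p =
  \bigcup_(u in tangent_space 3 iota setT p `\ 0%R)
     normal_section_curvature_ellipse iota p u.
Proof.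
rewrite eqEsubset; split=> [eta [U [phi [x [Fp [v v1 <-]]]]]|eta].
  have [[Uo Ux] _ _ Fs Ffree] := Fp.
  set F := iota \o phi in v1 *.
  (* A tangent vector orthogonal to ['d F x v] is sought; its parameter [z] lies in the kernel of a
     matrix with three rows and one column, which is nonzero. *)
  have [z z0 zv] : exists2 z : 'rV[R]_3, z != 0 &
      z *m ('J F x *m ('d F x v)^T) = 0.
    set A := 'J F x *m _.
    have : kermx A != 0.
      rewrite -mxrank_eq0 mxrank_ker -lt0n subn_gt0.
      by rewrite (leq_ltn_trans (rank_leq_col _)).
    by move=> /rowV0Pn[z /sub_kermxP zA z0]; exists z.
  pose u := z *m 'J F x.
  have uT : (u <= 'J F x)%MS by exact: submxMl.
  have u0 : u != 0.
    apply: contraNneq z0 => u0; apply/eqP.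
    by apply: (row_free_inj (Ffree x Ux)); rewrite mul0mx.
  exists u; first by split; [exists U, phi, x|exact/eqP].
  have [V [psi [y Gp]]] := normal_section_param Fp uT u0.
  have [DG Dv] := second_fundamental_form_section Fp Gp uT u0.
  have [|w wv] := Dv v.
    apply/eqP; rewrite edot_eq0 -trmx_eq0 trmx_mul trmxK /u -mulmxA.
    exact/eqP.
  exists V, psi, y; split=> //; exists w; first by rewrite /= wv.
  have [v' [v'w <-]] := DG w.
  (* [v'] and [v] have the same image under the injective differential of [F]. *)
  suff -> : v' = v by [].
  apply: (row_free_inj (Ffree x Ux)) => /=.
  by rewrite !mul_rV_lin1 v'w.
(* Conversely, the parametrisation that witnesses the tangency of [u] also exhibits the point of the
   ellipse as a point of the locus. *)
move=> [u [[U [phi [x [Fp uT]]]] /eqP u0]].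
move=> [V [psi [y [Gp [w w1 <-]]]]].
have [DG _] := second_fundamental_form_section Fp Gp uT u0.
have [v [vw Dv]] := DG w.
exists U, phi, x; split=> //; exists v; first by rewrite /= vw.
exact: Dv.
Qed.
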